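(* The triple $(G,\cdot,\triangleleft)$ is a (right) post-group, with Grossman--Larson group $(G,\star)$ whose product $\star: G\times G\to G$ is $$(\mathbf{c},\mathbf{d})\longmapsto \mathbf{c}\star\mathbf{d} := (\mathbf{c}\triangleleft\mathbf{d})\cdot\mathbf{d}.$$ In particular, if $\mathbf{c}=c_1\mathrm{e}_1+c_2\mathrm{e}_2$ and $\mathbf{d}=d_1\mathrm{e}_1+d_2\mathrm{e}_2$ are in $G$, then $$\mathbf{c}\star\mathbf{d}=\begin{bmatrix}(c_1\,\tilde\circ\,\mathbf{d})\sqcup\!\sqcup\, d_1 & \; c_2\,\tilde\circ\,\mathbf{d}+(c_1\,\tilde\circ\,\mathbf{d})\sqcup\!\sqcup\, d_2\end{bmatrix}^t .$$
   Context: Let $X=\{x_0,x_1\}$, let $X^*$ be the free monoid of words over $X$, with empty word denoted $\emptyset$ (also written $1$), and let $\mathbb{R}\langle\langle X\rangle\rangle$ be the space of all formal power series $c=\sum_{\eta\in X^*}c(\eta)\eta$ with $c(\eta)\in\mathbb{R}$; $c(1)$ is the coefficient of the empty word. For a letter $x_i$, $x_i c$ denotes left concatenation, $x_ic=\sum_\eta c(\eta)\,x_i\eta$. The shuffle product $\sqcup\!\sqcup$ on $\mathbb{R}\langle\langle X\rangle\rangle$ is the commutative associative product with unit $\emptyset$ determined (bilinearly, extended to series) by $(x_i\eta)\sqcup\!\sqcup(x_j\xi)=x_i(\eta\sqcup\!\sqcup x_j\xi)+x_j(x_i\eta\sqcup\!\sqcup\xi)$; equivalently it is the convolution product dual to the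 unshuffle coproduct for which each letter is primitive. Let $\mathbb{R}\langle\langle X\rangle\rangle^2$ be the space of pairs $\mathbf{c}=[c_1\;c_2]^t=c_1\mathrm{e}_1+c_2\mathrm{e}_2$ with $c_1,c_2\in\mathbb{R}\langle\langle X\rangle\rangle$. For $c\in\mathbb{R}\langle\langle X\rangle\rangle$ and $\mathbf{d}=[d_1\;d_2]^t\in\mathbb{R}\langle\langle X\rangle\rangle^2$ the mixed composition product is $c\,\tilde\circ\,\mathbf{d}:=\sum_{\eta\in X^*}c(\eta)\,(\eta\,\tilde\circ\,\mathbf{d})$, where inductively $\emptyset\,\tilde\circ\,\mathbf{d}=\emptyset$, $\;x_0\eta\,\tilde\circ\,\mathbf{d}=x_0(\eta\,\tilde\circ\,\mathbf{d})$, $\;x_1\eta\,\tilde\circ\,\mathbf{d}=x_1\big(d_1\sqcup\!\sqcup(\eta\,\tilde\circ\,\mathbf{d})\big)+x_0\big(d_2\sqcup\!\sqcup(\eta\,\tilde\circ\,\mathbf{d})\big)$. It is extended component-wise: $\mathbf{c}\triangleleft\mathbf{d}:=[c_1\,\tilde\circ\,\mathbf{d}\;\;c_2\,\tilde\circ\,\mathbf{d}]^t$. Let $G:=\{\mathbf{c}\in\mathbb{R}\langle\langle X\rangle\rangle^2: c_1(1)=1\}$, with product $\mathbf{c}\cdot\mathbf{d}:=[\,c_1\sqcup\!\sqcup d_1\;\;\; c_2+(c_1\sqcup\!\sqcup d_2)\,]^t$ and with $\triangleleft$ restricted to $G$. A (right) post-group is a group $(G,\cdot)$ with a map $\triangleleft:G\times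 G\to G$ such that (i) for every $a\in G$ the map $R^\triangleleft_a:G\to G$, $R^\triangleleft_a(b):=b\triangleleft a$, is an automorphism of the group $(G,\cdot)$; and (ii) for all $a,b\in G$, $R^\triangleleft_a\circ R^\triangleleft_b=R^\triangleleft_{R^\triangleleft_a(b)\cdot a}$. Its Grossman--Larson group is $G$ equipped with the group product $b\star a:=(b\triangleleft a)\cdot a$. *)

(* Defs.v *)
From HB Require Import structures.
From mathcomp Require Import all_boot all_order all_algebra.
From mathcomp Require Import all_classical all_reals.

Set Implicit Arguments.
Unset Strict Implicit.
Unset Printing Implicit Defensive.

Import Order.TTheory GRing.Theory Num.Theory.

Local Open Scope classical_set_scope.
Local Open Scope ring_scope.

(** * Groups and post-groups *)

(* [mul] is the product of some [groupType] structure on [T]. *)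
Definition is_group (T : Type) (mul : T -> T -> T) : Prop :=
  exists g : Group.axioms_ T,
    mul = @monoid.mul (Group.Pack g).

Lemma is_groupP (T : Type) (mul : T -> T -> T) :
  is_group mul <->
  exists (one : T) (inv : T -> T),
    [/\ associative mul, left_id one mul, right_id one mul,
        left_inverse one inv mul & right_inverse one inv mul].
Proof.
split=> [[g ->]|[one [inv [mulA mul1 mulr1 mulV mulrV]]]].
  pose gT : groupType := Group.Pack g.
  exists (@monoid.one gT), (@monoid.inv gT).
  by split=> [x y z|x|x|x|x];
    [exact: (@monoid.mulgA gT)|exact: (@monoid.mul1g gT)
    |exact: (@monoid.mulg1 gT)|exact: (@monoid.mulVg gT)
    |exact: (@monoid.mulgV gT)].
pose cT : choiceType := HB.pack T (gen_eqMixin T) (gen_choiceMixin T).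
pose gT : groupType := HB.pack T (Choice.on cT)
  (@isGroup.Build cT one inv mul mulA mul1 mulr1 mulV mulrV).
by exists (Group.class gT).
Qed.

Definition is_group_automorphism (T : Type) (mul : T -> T -> T) (f : T -> T) :
    Prop :=
  bijective f /\ {morph f : x y / mul x y}.

Definition right_action (T : Type) (tri : T -> T -> T) (a : T) : T -> T :=
  fun b => tri b a.

Record is_postgroup (T : Type) (mul tri : T -> T -> T) : Prop := IsPostgroup {
  postgroup_group : is_group mul;
  postgroup_aut : forall a, is_group_automorphism mul (right_action tri a);
  postgroup_comp : forall a b,
    right_action tri a \o right_action tri b =
    right_action tri (mul (right_action tri a b) a)
}.

Definition grossman_larson (T : Type) (mul tri : T -> T -> T) (b a : T) : T :=
  mul (tri b a) a.

(** * Noncommutative formal power series over X = {x0, x1} *)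

Definition letter : Type := bool.
Notation x0 := (false : letter).
Notation x1 := (true : letter).
Notation word := (seq bool).

(* A series is its coefficient function, with pointwise addition. *)
Notation series R := (word -> R).

Section Series.
Variable R : realType.
Implicit Types (c d : series R) (v w : word).

Definition monomial v : series R := fun w => (w == v)%:R.

Definition lconcat (i : letter) c : series R :=
  fun w => if w is j :: w' then if j == i then c w' else 0 else 0.

Fixpoint shuffle_word (v w : word) {struct v} : series R :=
  if v is i :: v' then
    (fix shuffle_v (w : word) : series R :=
       if w is j :: w' then
         lconcat i (shuffle_word v' w) + lconcat j (shuffle_v w')
       else monomial v) w
  else monomial w.

Lemma shuffle_word0w w : shuffle_word [::] w = monomial w.
Proof. by []. Qed.

Lemma shuffle_wordw0 v : shuffle_word v [::] = monomial v.
Proof. by case: v. Qed.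

Lemma shuffle_word_cons i v j w :
  shuffle_word (i :: v) (j :: w) =
    lconcat i (shuffle_word v (j :: w)) + lconcat j (shuffle_word (i :: v) w).
Proof. by []. Qed.

(* Both infinite sums below are coefficientwise sums with finite support: the
   words of [shuffle_word v w] have length [size v + size w], and those of
   [mixed_word v d] have length at least [size v]. *)
Definition shuffle c d : series R := fun w =>
  \sum_(p \in [set: word * word]) c p.1 * d p.2 * shuffle_word p.1 p.2 w.

Fixpoint mixed_word (v : word) (d : series R * series R) : series R :=
  if v is i :: v' then
    let e := mixed_word v' d in
    if i == x0 then lconcat x0 e
    else lconcat x1 (shuffle d.1 e) + lconcat x0 (shuffle d.2 e)
  else monomial [::].

Definition mixed_comp c (d : series R * series R) : series R := fun w =>
  \sum_(v \in [set: word]) c v * mixed_word v d w.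

Lemma shuffle_nil c d : shuffle c d [::] = c [::] * d [::].
Proof.
rewrite /shuffle -(@fsbig_widen _ _ _ _ [set ([::], [::])]) ?fsbig_set1//=.
  by rewrite /monomial eqxx mulr1.
move=> [[|i v] [|j w]] [_ /= ne] //=; rewrite /monomial ?mulr0 //.
by rewrite [X in _ * X]addr0 mulr0.
Qed.

Lemma mixed_comp_nil c (d : series R * series R) :
  mixed_comp c d [::] = c [::].
Proof.
rewrite /mixed_comp -(@fsbig_widen _ _ _ _ [set [::]]) ?fsbig_set1//=.
  by rewrite /monomial eqxx mulr1.
move=> [|[] v] [_ /= ne] //=; rewrite ?mulr0 //.
by rewrite [X in _ * X]addr0 mulr0.
Qed.

(** * The operations on pairs of series and on G *)

Definition pair_mul (c d : series R * series R) : series R * series R :=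
  (shuffle c.1 d.1, c.2 + shuffle c.1 d.2).

Definition pair_tri (c d : series R * series R) : series R * series R :=
  (mixed_comp c.1 d, mixed_comp c.2 d).

Definition in_G (c : series R * series R) : bool := c.1 [::] == 1.

Definition G : Type := {c : series R * series R | in_G c}.

Lemma pair_mul_subproof (c d : G) : in_G (pair_mul (sval c) (sval d)).
Proof. by rewrite /in_G /= shuffle_nil (eqP (valP c)) (eqP (valP d)) mulr1. Qed.

Lemma pair_tri_subproof (c d : G) : in_G (pair_tri (sval c) (sval d)).
Proof. rewrite /in_G /= mixed_comp_nil; exact: (valP c). Qed.

Definition G_mul (c d : G) : G := exist in_G _ (pair_mul_subproof c d).

Definition G_tri (c d : G) : G := exist in_G _ (pair_tri_subproof c d).

End Series.

(* Main.v *)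
Require Import Defs.
From mathcomp Require Import all_boot all_order all_algebra.
From mathcomp Require Import all_classical all_reals.
Local Open Scope ring_scope.

Set Implicit Arguments.
Unset Strict Implicit.
Unset Printing Implicit Defensive.

Import GRing.Theory.

(** A series [c] is determined by its constant coefficient [c [::]] and its two
left derivatives [deriv i c], and both products have a simple description in
these terms.
Write [a b] for the shuffle product and [c o a] for the mixed composition.
Each [deriv i] is a derivation of the shuffle product ([deriv_shuffle]), and
  [deriv x1 (c o a) = a.1 (deriv x1 c o a)],
  [deriv x0 (c o a) = deriv x0 c o a + a.2 (deriv x1 c o a)]
([deriv1_mixed_comp], [deriv0_mixed_comp]), while constant coefficients are
multiplied, respectively preserved.  Once the infinite sums that define the two
products have been replaced by these rules, every identity between series is
proved in the same way: compare constant coefficients, take derivatives, and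
recognize on both sides the same expression in series that satisfy the identity
already on shorter words.

In this way [- o a] is a morphism for the shuffle product
([mixed_comp_shuffle]), hence for the product of [G], and
[(c o b) o a = c o ((b tri a) a)] where the last product is that of [G]
([mixed_comp_tri]); the latter is the composition law of a post-group.  A series
with constant coefficient 1 is invertible for the shuffle product
([shuffle_inv_exists]), because shuffling by [1 - c] raises the valuation, so that
[d |-> 1 + (1 - c) d] is a contraction.  This makes [G] a group, and it also
makes [- o a] bijective when [a.1] has constant coefficient 1: then
[c o a = g] can be solved for [deriv x1 c o a] and next for [deriv x0 c o a],
and so on letter by letter.

That the Grossman-Larson product is a group law is a formal consequence of the
post-group axioms ([is_group_grossman_larson]). *)

(** * Groups and post-groups *)

Lemma is_group_left (T : Type) (mul : T -> T -> T) (e : T) :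
  associative mul -> left_id e mul -> (forall x, exists y, mul y x = e) ->
  is_group mul.
Proof.
move=> mulA mul1x /boolp.choice[inv mulVx]; apply/is_groupP; exists e, inv.
have mulxV x : mul x (inv x) = e.
  by rewrite -[LHS]mul1x -{1}(mulVx (inv x)) -mulA (mulA (inv x)) mulVx mul1x.
by split=> // x; rewrite -(mulVx x) mulA mulxV mul1x.
Qed.

(** Associativity of [c * a := (c tri a) a] combines the morphism property of
[- tri a] with the composition law.  The inverse of [a] is the element [c] such
that [c tri a] is the inverse of [a] in the original group; it exists because
[- tri a] is onto. *)
Lemma is_group_grossman_larson (T : Type) (mul tri : T -> T -> T) :
  is_postgroup mul tri -> is_group (grossman_larson mul tri).
Proof.
case=> /is_groupP[e [inv [mulA mul1x mulx1 mulVx mulxV]]] aut comp.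
have morph a b c : tri (mul b c) a = mul (tri b a) (tri c a).
  by have [_ /(_ b c)] := aut a.
have triE a b c : tri (tri c b) a = tri c (mul (tri b a) a).
  exact: (congr1 (@^~ c) (comp a b)).
have idem x : mul x x = x -> x = e.
  by move=> xx; rewrite -(mulVx x) -{3}xx mulA mulVx mul1x.
have tri1x a : tri e a = e by apply: idem; rewrite -morph mul1x.
apply: (@is_group_left _ _ e) => [c b a|a|a]; rewrite /grossman_larson.
- by rewrite morph triE mulA.
- by rewrite tri1x mul1x.
have [[R' _ R'K] _] := aut a.
by exists (R' (inv a)); rewrite [tri _ _]R'K mulVx.
Qed.

(** * Derivatives and agreement up to a given length *)

Section Series.
Variable R : realType.
Implicit Types (c d e : series R) (v w : word) (i j : letter) (n : nat).

Definition deriv i c : series R := fun w => c (i :: w).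

(** Balls of the ultrametric on series: words of length [< n], rather than
[<= n], so that [agree 0] is trivial and inductions on [n] start for free. *)
Definition agree n c d := forall w, (size w < n)%N -> c w = d w.

Lemma agree_refl n c : agree n c c. Proof. by []. Qed.

Lemma eq_agree c d : (forall n, agree n c d) -> c = d.
Proof. by move=> cd; apply/funext => w; apply: (cd (size w).+1). Qed.

Lemma agreeS n c d :
  c [::] = d [::] -> (forall i, agree n (deriv i c) (deriv i d)) ->
  agree n.+1 c d.
Proof. by move=> cd0 cdS [|i w]// ltwn; apply: cdS. Qed.

Lemma agree_deriv n c d i :
  agree n.+1 c d -> agree n (deriv i c) (deriv i d).
Proof. by move=> cd w ltwn; apply: cd. Qed.

Lemma agree_le m n c d : (m <= n)%N -> agree n c d -> agree m c d.
Proof. by move=> lemn cd w ltwm; apply/cd/(leq_trans ltwm). Qed.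

Lemma agreeD n c d c' d' :
  agree n c c' -> agree n d d' -> agree n (c + d) (c' + d').
Proof. by move=> cc dd w ltw; congr (_ + _); [apply: cc | apply: dd]. Qed.

Lemma seriesDE c d w : (c + d) w = c w + d w.
Proof. by []. Qed.

Lemma derivD i c d : deriv i (c + d) = deriv i c + deriv i d.
Proof. by []. Qed.

(** The [n]-th iterate of [F] is stationary on words of length [< n], so the
coefficient of [w] in the limit is read off the iterate [(size w).+1]. *)
Lemma contraction_fixpoint (F : series R -> series R) :
  (forall n c d, agree n c d -> agree n.+1 (F c) (F d)) -> exists c, c = F c.
Proof.
move=> contr; pose c n : series R := iter n F 0.
have cE m n : (m <= n)%N -> agree m (c m) (c n).
  by elim: m n => [|m IHm] [|n]// lemn; apply: contr; apply: IHm.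
exists (fun w => c (size w).+1 w); apply: eq_agree => -[//|n] w ltwn.
rewrite (cE _ n.+1)//; apply: (contr n) => // u ltun.
by rewrite (cE (size u).+1 n).
Qed.

(** * The shuffle product through derivatives *)

(** All words of length at most [n], listed so that a sum over [words n.+1]
splits according to the first letter, as [deriv] does. *)
Fixpoint words n : seq word :=
  if n is n'.+1
  then [::] :: map (cons x0) (words n') ++ map (cons x1) (words n')
  else [:: [::]].

Lemma mem_words n w : (w \in words n) = (size w <= n)%N.
Proof.
have cons_inj i : injective (cons i : word -> word) by move=> u v [].
elim: n w => [|n IHn] [|[] w] //=; rewrite inE mem_cat /=.
  rewrite (mem_map (cons_inj _)) IHn ltnS; case: mapP => // -[].
  by move=> u _.
rewrite (mem_map (cons_inj _)) IHn ltnS orbC; case: mapP => // -[].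
by move=> u _.
Qed.

Lemma uniq_words n : uniq (words n).
Proof.
have cons_inj i : injective (cons i : word -> word) by move=> u v [].
elim: n => //= n IHn; rewrite cat_uniq !map_inj_uniq// IHn /= mem_cat andbT.
apply/andP; split; first by apply/norP; split; apply/mapP => -[].
by apply/hasPn => _ /mapP[u _ ->]; apply/mapP => -[].
Qed.

Lemma sum_wordsS n (F : word -> R) :
  \sum_(v <- words n.+1) F v =
    F [::] + (\sum_(v <- words n) F (x0 :: v) + \sum_(v <- words n) F (x1 :: v)).
Proof. by rewrite big_cons big_cat !big_map. Qed.

Lemma shuffle_word_size v u w :
  shuffle_word R v u w != 0 -> size w = (size v + size u)%N.
Proof.
have monP v' w' : monomial R v' w' != 0 -> size w' = size v'.
  by rewrite /monomial; have [->//|_] := eqVneq w' v'; rewrite eqxx.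
elim: v u w => [|i v IHv] u w; first exact: monP.
elim: u w => [|j u IHu] w; first by rewrite addn0; apply: monP.
rewrite shuffle_word_cons; case: w => [|k w].
  by rewrite [X in X != _]addr0 eqxx.
rewrite seriesDE /=.
have [] := eqVneq k i; have [] := eqVneq k j => _ _; rewrite ?addr0 ?add0r.
- have [->|/IHv->] := eqVneq (shuffle_word R v (j :: u) w) 0.
    by rewrite add0r => /IHu->; rewrite /= addnS.
  by [].
- by move=> /IHv->.
- by move=> /IHu->; rewrite /= addnS.
by rewrite eqxx.
Qed.

(** By homogeneity of [shuffle_word], only factors of length at most [size w]
contribute.  The two bounds are independent because removing a letter
shortens only one of the two factors. *)
Lemma shuffle_sumE n m c d w : (size w <= n)%N -> (size w <= m)%N ->
  shuffle c d w =
    \sum_(v <- words n) \sum_(u <- words m) c v * d u * shuffle_word R v u w.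
Proof.
move=> lewn lewm; pose s := [seq (v, u) | v <- words n, u <- words m].
have us : uniq s.
  by apply: allpairs_uniq; rewrite ?uniq_words// => -[? ?] [? ?] _ _ [-> ->].
rewrite /shuffle -(@fsbig_widen _ _ _ _ [set` s])//=.
  by rewrite -fsbig_seq// big_allpairs.
move=> [v u] [_ /=]; have [->|/shuffle_word_size szw]
    := eqVneq (shuffle_word R v u w) 0.
  by rewrite mulr0.
by case; apply: allpairs_f; rewrite mem_words;
  [apply: leq_trans lewn | apply: leq_trans lewm]; rewrite szw ?leq_addr ?leq_addl.
Qed.

(** Uniform in [v] and [u]: with an empty factor, where [shuffle_word] is a
monomial, the missing term of the derivation rule is zero. *)
Lemma shuffle_word_deriv v u i w : shuffle_word R v u (i :: w) =
  (if v is j :: v' then if j == i then shuffle_word R v' u w else 0 else 0) +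
  (if u is j :: u' then if j == i then shuffle_word R v u' w else 0 else 0) :> R.
Proof.
case: v u => [|j v] [|k u].
- by rewrite addr0.
- by rewrite add0r /= /monomial eqseq_cons eq_sym; case: eqP.
- by rewrite addr0 !shuffle_wordw0 /monomial eqseq_cons eq_sym; case: eqP.
by rewrite shuffle_word_cons seriesDE /= ![_ == i]eq_sym.
Qed.

(** Together with [shuffle_nil] this determines the shuffle product; the algebra
laws below are inductions on the word using only these two rules. *)
Lemma deriv_shuffle i c d :
  deriv i (shuffle c d) = shuffle (deriv i c) d + shuffle c (deriv i d).
Proof.
apply/funext => w; rewrite seriesDE /deriv.
rewrite (@shuffle_sumE (size w).+1 (size w).+1)//.
rewrite (@shuffle_sumE (size w) (size w).+1) ?leqnSn//.
rewrite (@shuffle_sumE (size w).+1 (size w)) ?leqnSn//.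
under eq_bigr => v _.
  under eq_bigr => u _ do rewrite shuffle_word_deriv mulrDr.
  rewrite big_split; over.
rewrite big_split /=; congr (_ + _).
  rewrite sum_wordsS big1 ?add0r => [|u _]; last by rewrite mulr0.
  case: i; last rewrite addrC.
    by rewrite big1 ?add0r // => v _; rewrite big1// => u _; rewrite mulr0.
  by rewrite big1 ?add0r // => v _; rewrite big1// => u _; rewrite mulr0.
apply: eq_bigr => v _; rewrite sum_wordsS mulr0 add0r.
case: i; last rewrite addrC.
  by rewrite big1 ?add0r // => u _; rewrite mulr0.
by rewrite big1 ?add0r // => u _; rewrite mulr0.
Qed.

Lemma shuffle_cons i c d w :
  shuffle c d (i :: w) = shuffle (deriv i c) d w + shuffle c (deriv i d) w.
Proof. exact: (congr1 (@^~ w) (deriv_shuffle i c d)). Qed.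

Lemma shuffleC c d : shuffle c d = shuffle d c.
Proof.
apply/funext => w; elim: w c d => [|i w IHw] c d.
  by rewrite !shuffle_nil mulrC.
by rewrite !shuffle_cons addrC IHw [X in _ + X]IHw.
Qed.

(** The form of linearity needed to shuffle a series with a truncation of a
mixed composition. *)
Lemma shuffle_sumr (I : Type) (r : seq I) (a : I -> R) (F : I -> series R) d :
  shuffle d (fun w => \sum_(k <- r) a k * F k w) =
  (fun w => \sum_(k <- r) a k * shuffle d (F k) w).
Proof.
apply/funext => w; elim: w d F => [|i w IHw] d F.
  rewrite shuffle_nil mulr_sumr; apply: eq_bigr => k _.
  by rewrite shuffle_nil mulrCA.
rewrite shuffle_cons IHw (IHw d (fun k => deriv i (F k))) -big_split /=.
by apply: eq_bigr => k _; rewrite shuffle_cons mulrDr.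
Qed.

Lemma shuffleDr d c e : shuffle d (c + e) = shuffle d c + shuffle d e.
Proof.
apply/funext => w; elim: w d c e => [|i w IHw] d c e.
  by rewrite seriesDE !shuffle_nil mulrDr.
rewrite seriesDE !shuffle_cons derivD !IHw.
exact: addrACA.
Qed.

Lemma shuffleNr d c : shuffle d (- c) = - shuffle d c.
Proof.
have: shuffle d 0 = shuffle d 0 + shuffle d 0 by rewrite -shuffleDr addr0.
rewrite -[LHS]addr0 => /addrI shuffle0.
by apply/eqP; rewrite -addr_eq0 -shuffleDr addNr -shuffle0.
Qed.

Lemma shuffle0r d : shuffle d 0 = 0.
Proof. by rewrite -[X in shuffle d X](subrr 0) shuffleDr shuffleNr subrr. Qed.

Lemma shuffleDl d c e : shuffle (c + e) d = shuffle c d + shuffle e d.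
Proof. by rewrite shuffleC shuffleDr !(shuffleC d). Qed.

Lemma shuffleNl d c : shuffle (- c) d = - shuffle c d.
Proof. by rewrite shuffleC shuffleNr shuffleC. Qed.

Lemma shuffleA : associative (@shuffle R).
Proof.
move=> c d e; apply/funext => w; elim: w c d e => [|i w IHw] c d e.
  by rewrite !shuffle_nil mulrA.
rewrite !shuffle_cons !deriv_shuffle shuffleDl shuffleDr.
rewrite !seriesDE !IHw; exact: addrA.
Qed.

Lemma shuffle1l : left_id (monomial R [::]) (@shuffle R).
Proof.
move=> c; apply/funext => w; elim: w c => [|i w IHw] c.
  by rewrite shuffle_nil mul1r.
by rewrite shuffle_cons IHw shuffleC (shuffle0r c) [LHS]add0r.
Qed.

Lemma shuffleCA c d e : shuffle c (shuffle d e) = shuffle d (shuffle c e).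
Proof. by rewrite !shuffleA (shuffleC c). Qed.

(** Shuffling adds the lengths of words, so it never moves a coefficient towards
shorter words. *)
Lemma agree_shuffle n d c c' :
  agree n c c' -> agree n (shuffle d c) (shuffle d c').
Proof.
elim: n d c c' => // n IHn d c c' cc; apply: agreeS => [|i].
  by rewrite !shuffle_nil cc.
rewrite !deriv_shuffle; apply: agreeD; apply: IHn; last exact: agree_deriv.
exact: agree_le cc.
Qed.

(** What makes [shuffle d] a contraction: all words of [d] have positive
length. *)
Lemma agree_shuffle_proper n d c c' : d [::] = 0 ->
  agree n c c' -> agree n.+1 (shuffle d c) (shuffle d c').
Proof.
move=> d0; elim: n c c' => [|n IHn] c c' cc; apply: agreeS => //;
  rewrite ?shuffle_nil ?d0 ?mul0r// => i.
rewrite !deriv_shuffle; apply: agreeD; first exact: agree_shuffle.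
by apply: IHn; apply: agree_deriv.
Qed.

(** The inverse is the Neumann series of [1 - c], that is the fixed point of
[d |-> 1 + (1 - c) d]. *)
Lemma shuffle_inv_exists c : c [::] = 1 ->
  exists d, shuffle d c = monomial R [::].
Proof.
move=> c0; pose r := monomial R [::] - c.
have r0 : r [::] = 0 by rewrite -(subrr (1 : R)) -{2}c0.
have [n d d' dd'|d dE] :=
    @contraction_fixpoint (fun d => monomial R [::] + shuffle r d).
  by apply: agreeD; [exact: agree_refl | exact: agree_shuffle_proper].
exists d; rewrite shuffleC; apply/eqP; rewrite -subr_eq0 -oppr_eq0 opprB.
move: dE; rewrite shuffleDl shuffleNl shuffle1l addrCA -[X in X = _]addr0.
by move=> /addrI<-.
Qed.

(** * The mixed composition through derivatives *)

Implicit Types a b : series R * series R.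

(** Every letter of [v] contributes one new letter, [x0] or [x1], in front;
hence the sum defining [mixed_comp] is finite on each coefficient. *)
Lemma mixed_word_small v a w : (size w < size v)%N -> mixed_word v a w = 0.
Proof.
elim: v w => [//|i v IHv] [|j w] ltwv /=.
  by case: i {ltwv} => //; exact: addr0.
have shuffle_small d : shuffle d (mixed_word v a) w = 0.
  rewrite (@agree_shuffle (size w).+1 d _ 0) ?shuffle0r// => u leuw.
  by rewrite IHv// (leq_trans leuw).
case: i {ltwv} (ltwv : size w < size v)%N => ltwv /=; last first.
  by case: eqP => // _; rewrite IHv.
by rewrite seriesDE /= !shuffle_small !if_same addr0.
Qed.

Lemma mixed_comp_sumE n c a w : (size w <= n)%N ->
  mixed_comp c a w = \sum_(v <- words n) c v * mixed_word v a w.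
Proof.
move=> lewn; rewrite /mixed_comp -(@fsbig_widen _ _ _ _ [set` words n])//=.
  by rewrite -fsbig_seq ?uniq_words.
move=> v [_ /= /negP]; rewrite mem_words -ltnNge => ltnv.
by rewrite mixed_word_small ?mulr0// (leq_ltn_trans lewn).
Qed.

Lemma shuffle_mixed_comp d c a n w : (size w <= n)%N ->
  shuffle d (mixed_comp c a) w =
    \sum_(v <- words n) c v * shuffle d (mixed_word v a) w.
Proof.
move=> lewn; rewrite -[RHS](congr1 (@^~ w) (shuffle_sumr _ _ _ _)).
apply: (@agree_shuffle n.+1) => // u leun; exact: mixed_comp_sumE.
Qed.

Lemma deriv1_mixed_comp c a :
  deriv x1 (mixed_comp c a) = shuffle a.1 (mixed_comp (deriv x1 c) a).
Proof.
apply/funext => w; rewrite (@shuffle_mixed_comp _ _ _ (size w))// /deriv.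
rewrite (@mixed_comp_sumE (size w).+1)// sum_wordsS mulr0 add0r.
rewrite big1 ?add0r => [|v _]; last by rewrite mulr0.
by apply: eq_bigr => v _; congr (_ * _); exact: addr0.
Qed.

Lemma deriv0_mixed_comp c a :
  deriv x0 (mixed_comp c a) =
    mixed_comp (deriv x0 c) a + shuffle a.2 (mixed_comp (deriv x1 c) a).
Proof.
apply/funext => w; rewrite seriesDE (@shuffle_mixed_comp _ _ _ (size w))//.
rewrite (@mixed_comp_sumE (size w))// /deriv.
rewrite (@mixed_comp_sumE (size w).+1)// sum_wordsS mulr0 add0r; congr (_ + _).
by apply: eq_bigr => v _; congr (_ * _); exact: add0r.
Qed.

Lemma mixed_compD c d a :
  mixed_comp (c + d) a = mixed_comp c a + mixed_comp d a.
Proof.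
apply/funext => w; rewrite seriesDE !(@mixed_comp_sumE (size w))//.
by rewrite -big_split; apply: eq_bigr => v _; exact: mulrDl.
Qed.

(** On both sides [deriv i] acts by a Leibniz rule.  The factors [a.1] and [a.2]
that it produces occur on the outside on the left-hand side and next to one of
the two factors on the right-hand side, which commutativity reconciles. *)
Lemma mixed_comp_shuffle c d a :
  mixed_comp (shuffle c d) a = shuffle (mixed_comp c a) (mixed_comp d a).
Proof.
apply: eq_agree => n; elim: n c d => // n IHn c d; apply: agreeS => [|[]].
- by rewrite mixed_comp_nil !shuffle_nil !mixed_comp_nil.
- rewrite deriv1_mixed_comp !deriv_shuffle !deriv1_mixed_comp mixed_compD.
  rewrite shuffleDr -shuffleA [X in agree _ _ (_ + X)]shuffleCA.
  by apply: agreeD; apply: agree_shuffle.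
rewrite deriv0_mixed_comp !deriv_shuffle !deriv0_mixed_comp !mixed_compD.
rewrite !(shuffleDr, shuffleDl) -!shuffleA.
rewrite [X in agree _ _ (_ + (_ + X))]shuffleCA [X in agree _ _ X]addrACA.
by do 2![apply: agreeD]; try apply: agree_shuffle.
Qed.

(** Taking the derivative by [x1] on the left gives first [b.1], then [a.1], in
total the shuffle of [b.1 o a] with [a.1]; the derivative by [x0] likewise
collects [b.2 o a + (b.1 o a) a.2].  These are the components of
[pair_mul (pair_tri b a) a]. *)
Lemma mixed_comp_tri c a b :
  mixed_comp (mixed_comp c b) a = mixed_comp c (pair_mul (pair_tri b a) a).
Proof.
apply: eq_agree => n; elim: n c => // n IHn c; apply: agreeS => [|[]].
- by rewrite !mixed_comp_nil.
- rewrite !deriv1_mixed_comp mixed_comp_shuffle shuffleA (shuffleC a.1).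
  exact: agree_shuffle.
rewrite !deriv0_mixed_comp deriv1_mixed_comp mixed_compD !mixed_comp_shuffle.
rewrite shuffleA (shuffleC a.2) -addrA -shuffleDl.
by apply: agreeD; last apply: agree_shuffle.
Qed.

Section MixedCompInverse.
Variables (a : series R * series R) (b : series R).
Hypothesis ba1 : shuffle b a.1 = monomial R [::].

(** If [f o a = c], the derivation rules give [deriv x1 f o a = b (deriv x1 c)],
called [d] below, and [deriv x0 f o a = deriv x0 c - a.2 d]; the recursion solves
these two equations for the derivatives of [f]. *)
Fixpoint mixed_comp_inv_rec w c : R :=
  if w is i :: w' then
    let d := shuffle b (deriv x1 c) in
    mixed_comp_inv_rec w' (if i == x1 then d else deriv x0 c - shuffle a.2 d)
  else c [::].

Definition mixed_comp_inv c : series R := mixed_comp_inv_rec^~ c.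

Lemma mixed_compK : cancel (fun c => mixed_comp c a) mixed_comp_inv.
Proof.
move=> c; apply/funext => w; elim: w c => [|i w IHw] c.
  exact: mixed_comp_nil.
rewrite /mixed_comp_inv /= deriv1_mixed_comp shuffleA ba1 shuffle1l.
case: i => /=; first exact: IHw.
by rewrite deriv0_mixed_comp addrK; apply: IHw.
Qed.

Lemma mixed_comp_invK : cancel mixed_comp_inv (fun c => mixed_comp c a).
Proof.
move=> c; apply: eq_agree => n; elim: n c => // n IHn c; apply: agreeS => [|[]].
- by rewrite mixed_comp_nil.
- rewrite deriv1_mixed_comp -[X in agree _ _ X]shuffle1l -ba1 (shuffleC b).
  by rewrite -shuffleA; apply: agree_shuffle; apply: IHn.
rewrite deriv0_mixed_comp.
rewrite -[X in agree _ _ X](subrK (shuffle a.2 (shuffle b (deriv x1 c)))).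
by apply: agreeD; [|apply: agree_shuffle]; apply: IHn.
Qed.

End MixedCompInverse.

(** * The post-group of pairs of series *)

Lemma G_inj (c d : G R) : sval c = sval d -> c = d.
Proof. exact: val_inj. Qed.

Lemma G_mul_group : is_group (@G_mul R).
Proof.
have one_G : in_G (monomial R [::], 0 : series R) by rewrite /in_G /monomial eqxx.
apply: (@is_group_left _ _ (exist (@in_G R) _ one_G)) => [c d e|c|c].
- apply: G_inj; congr (_, _) => /=; first exact: shuffleA.
  by rewrite shuffleDr shuffleA addrA.
- by apply: G_inj; case: c => -[c1 c2] Gc; congr (_, _) => /=;
    rewrite ?add0r shuffle1l.
have [b bc] := shuffle_inv_exists (eqP (valP c)).
have Gb : in_G (b, - shuffle b (sval c).2).
  by apply/eqP; rewrite -[LHS]mulr1 -[X in _ * X](eqP (valP c)) -shuffle_nil bc.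
exists (exist (@in_G R) _ Gb); apply: G_inj; congr (_, _) => //=.
exact: addNr.
Qed.

Lemma G_tri_aut (a : G R) :
  is_group_automorphism (@G_mul R) (right_action (@G_tri R) a).
Proof.
split; last first.
  move=> c d; apply: G_inj; congr (_, _) => /=; first exact: mixed_comp_shuffle.
  by rewrite mixed_compD mixed_comp_shuffle.
have [b ba1] := shuffle_inv_exists (eqP (valP a)).
pose inv := mixed_comp_inv (sval a) b.
have Ginv (c : G R) : in_G (inv (sval c).1, inv (sval c).2) by exact: (valP c).
exists (fun c : G R => exist (@in_G R) _ (Ginv c)) => -[[c1 c2] Gc]; apply: G_inj.
  by congr (_, _); apply: mixed_compK.
by congr (_, _); apply: mixed_comp_invK.
Qed.

Lemma G_postgroup : is_postgroup (@G_mul R) (@G_tri R).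
Proof.
split=> [|a|a b]; [exact: G_mul_group | exact: G_tri_aut |].
by apply/funext => c; apply: G_inj; congr (_, _); apply: mixed_comp_tri.
Qed.

End Series.

Theorem theorem4p4 (R : realType) :
  let star := grossman_larson (@G_mul R) (@G_tri R) in
  [/\ is_postgroup (@G_mul R) (@G_tri R),
      is_group star,
      (forall c d : G R, star c d = G_mul (G_tri c d) d) &
      (forall c d : G R,
         sval (star c d) =
           (shuffle (mixed_comp (sval c).1 (sval d)) (sval d).1,
            mixed_comp (sval c).2 (sval d)
              + shuffle (mixed_comp (sval c).1 (sval d)) (sval d).2))].
Proof.
split=> //; first exact: G_postgroup.
exact: is_group_grossman_larson (G_postgroup R).
Qed.
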